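(* For every $\epsilon>0$, there exists $d_0$ such that if $\Delta$ is a real number with $\Delta\ge d_0$ and $G$ is a graph with maximum degree at most $\Delta$, then there exists a proper $(a:b)$-coloring $\varphi$ of $G$ for some positive integers $a$ and $b$ with $a\le(1+\epsilon)\Delta b$ such that (1) $\varphi$ is a fractional proper conflict-free $(a:b)$-coloring of $G$; (2) for any set $C$ of colors with size less than $5b/2$, every component of the subgraph of $G$ induced by the vertices that use only colors in $C$ (i.e. the vertices $v$ with $\varphi(v)\subseteq C$) has at most two vertices; and (3) $|\varphi(v)\cap\varphi(w)|\le b/2$ for any distinct vertices $v,w$ of $G$.
   Context: Graphs are finite and simple. Write $[a]=\{1,\dots,a\}$. For positive integers $a,b$, an $(a:b)$-coloring $\varphi$ of $G$ assigns to each vertex $v$ a $b$-element subset $\varphi(v)$ of $[a]$ (whose elements are called colors). It is proper if for every $j\in[a]$ the set $\varphi^{-1}(j)=\{v: j\in\varphi(v)\}$ is a stable (independent) set in $G$. An $(a:b)$-coloring of $G$ is a fractional proper conflict-free coloring of $G$ if it is proper and for every non-isolated vertex $v$ of $G$ at least $b$ colors appear exactly once on $N(v)$, i.e. there are at least $b$ elements $\ell\in[a]$ with $|N(v)\cap\varphi^{-1}(\ell)|=1$, where $N(v)$ is the open neighborhood. *)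

(* Defs.v *)
From mathcomp Require Import all_boot all_order all_algebra.
From mathcomp Require Import reals.

Set Implicit Arguments.
Unset Strict Implicit.
Unset Printing Implicit Defensive.

Record sgraph := SGraph {
  vertex :> finType;
  edge : rel vertex;
  edge_sym : symmetric edge;
  edge_irrefl : irreflexive edge
}.

Section Graph.
Variable G : sgraph.

Definition nbh (v : G) : {set G} := [set w | edge v w].

Definition isolated (v : G) : Prop := nbh v = set0.

Definition max_degree : nat := \max_(v : G) #|nbh v|.

Definition stable (S : {set G}) : Prop :=
  forall v w : G, v \in S -> w \in S -> ~~ edge v w.

Definition induced_edge (S : {set G}) : rel G :=
  [rel v w | [&& v \in S, w \in S & edge v w]].

(* The vertex sets of the connected components of the subgraph induced by S. *)
Definition components (S : {set G}) : {set {set G}} :=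
  equivalence_partition (connect (induced_edge S)) S.

End Graph.

(* The colors are 0, ..., a - 1 rather than 1, ..., a. *)
Section Coloring.
Variables (G : sgraph) (a : nat).
Implicit Type phi : G -> {set 'I_a}.

Definition is_coloring (b : nat) phi : Prop := forall v : G, #|phi v| = b.

Definition color_class phi (j : 'I_a) : {set G} := [set v | j \in phi v].

Definition proper_coloring (b : nat) phi : Prop :=
  is_coloring b phi /\ forall j : 'I_a, stable (color_class phi j).

Definition colors_once phi (v : G) : {set 'I_a} :=
  [set l | #|nbh v :&: color_class phi l| == 1].

Definition fractional_pcf_coloring (b : nat) phi : Prop :=
  proper_coloring b phi /\
  forall v : G, ~ isolated v -> b <= #|colors_once phi v|.

Definition vertices_using_only phi (C : {set 'I_a}) : {set G} :=
  [set v | phi v \subset C].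

End Coloring.

(* Main.v *)
Require Import Defs.
From mathcomp Require Import all_boot all_order all_algebra.
From mathcomp Require Import reals.
From mathcomp Require Import fingroup perm zify lra.

(** The colors are the linear orders, encoded as permutations, of the disjoint
    union of the vertex set with a supply of dummy points.  Let D >= 2 bound the
    maximum degree, and pad every closed neighborhood N[v] with dummies to a set
    S(v) of exactly D + 1 points.  A vertex v receives the color s when v comes
    first in S(v) under s.  By symmetry each element of S(v) comes first equally
    often, so each vertex receives exactly the fraction p = 1 / (D + 1) of all
    colors: a = (D + 1) b.  Adjacent vertices lie in each other's sets S, so they
    share no color.

    All estimates come from one symmetry principle ([card_first_in]): among the
    orders in a family closed under transposing elements of B, each element of B
    comes first in B equally often.

    - If v and w are distinct and not adjacent and s is a color of both, either v
      precedes w, and then v is first in S(v) with w added, a set of D + 2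
      elements, while w is first in S(w).  The two events have joint probability
      at most p / (D + 2); exchanging v and w gives a total of at most
      2 p / (D + 2) <= p / 2 ([card_chosen2]).

    - Let v have degree d > 0, and for a neighbor x let A = S(x) U N[v], so that
      #|A| <= D + d.  With probability at least 1 / (D + d), x is first in A.
      Given this, each other neighbor y of v is first in S(y) with probability at
      most p, so x is the only neighbor of v with color s with probability at
      least (1 - (d - 1) p) / (D + d) ([card_chosen_only]).  These events are
      disjoint for distinct x, and their probabilities add up to at least
      d (D + 2 - d) / ((D + d) (D + 1)), which is at least p because
      d (D + 2 - d) - (D + d) = (d - 1) (D - d) >= 0 ([card_chosen_once]).

    Finally, a component with more than two vertices contains a path u - v - w, and its
    vertices use at least b + (2 b - b / 2) = 5 b / 2 colors
    ([bichromatic_component_le2]).  Taking D to be the larger of 2 and the maximum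
    degree, D + 1 <= (1 + eps) Delta as soon as Delta >= 2 and eps Delta >= 1. *)

Set Implicit Arguments.
Unset Strict Implicit.
Unset Printing Implicit Defensive.

Lemma card_bigcup_le (I W : finType) (P : pred I) (F : I -> {set W}) :
  #|\bigcup_(i | P i) F i| <= \sum_(i | P i) #|F i|.
Proof.
elim/big_ind2: _ => [|m A n B mA nB|//]; first by rewrite cards0.
by apply: leq_trans (leq_add mA nB); rewrite cardsU leq_subr.
Qed.

(** * Which element comes first in a random order *)

Section FirstInOrder.
Variable T : finType.
Implicit Types (A B : {set T}) (x y : T) (s : {perm T}).

(** A permutation s stands for the order in which y has position
    [enum_rank (s y)]; a set of such permutations plays the role of an event. *)
Definition first_in A x : {set {perm T}} :=
  [set s : {perm T} |
    (x \in A) && [forall y in A, enum_rank (s x) <= enum_rank (s y)]].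

Lemma first_inP A x s :
  reflect (x \in A /\ {in A, forall y, enum_rank (s x) <= enum_rank (s y)})
          (s \in first_in A x).
Proof.
rewrite inE; apply: (iffP andP) => -[xA h]; split => //.
  by move=> y yA; apply: (implyP (forallP h y)).
by apply/forallP => y; apply/implyP; apply: h.
Qed.

Lemma first_in_uniq A x y s :
  s \in first_in A x -> s \in first_in A y -> x = y.
Proof.
move=> /first_inP[xA hx] /first_inP[yA hy].
apply: (@perm_inj _ s); apply: enum_rank_inj; apply: val_inj.
by apply/eqP; rewrite eqn_leq hx // hy.
Qed.

Lemma first_in_ex A x s : x \in A -> exists y, s \in first_in A y.
Proof.
move=> xA; case: (arg_minnP (fun y => enum_rank (s y) : nat) xA) => y yA hy.
by exists y; apply/first_inP.
Qed.

Lemma first_in_sub A B x :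
  x \in A -> A \subset B -> first_in B x \subset first_in A x.
Proof.
move=> xA /subsetP sAB; apply/subsetP => s /first_inP[_ h].
by apply/first_inP; split => // y /sAB /h.
Qed.

(** Everything in B comes after y, and y comes after x. *)
Lemma first_in_sup A B x y s :
  y \in A -> s \in first_in A x -> s \in first_in B y ->
  s \in first_in (A :|: B) x.
Proof.
move=> yA /first_inP[xA hx] /first_inP[yB hy].
apply/first_inP; split; first by rewrite inE xA.
move=> z; rewrite inE => /orP[/hx // | /hy]; apply: leq_trans.
exact: hx.
Qed.

Lemma first_in_antisym A B x y s :
  x \in B -> y \in A -> s \in first_in A x -> s \in first_in B y -> x = y.
Proof.
move=> xB yA hA hB; have := first_in_sup yA hA hB.
rewrite setUC => hx; apply: (first_in_uniq hx).
by rewrite setUC in hx; have := first_in_sup xB hB hA.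
Qed.

Lemma first_in_tperm A x y z s :
  y \in A -> z \in A ->
  (tperm y z * s)%g \in first_in A x = (s \in first_in A (tperm y z x)).
Proof.
move=> yA zA; have tA u : (tperm y z u \in A) = (u \in A).
  by case: tpermP => // ->; rewrite yA zA.
apply/first_inP/first_inP => -[xA h]; split; rewrite ?tA // in xA *.
  by move=> u uA; have := h (tperm y z u); rewrite !permM tpermK tA; apply.
by move=> u uA; rewrite !permM; apply: h; rewrite tA.
Qed.

(** The first element of B under an order in P is uniformly distributed on B:
    composing with [tperm x y] is a bijection of P that turns the orders in which
    x is first into those in which y is first. *)
Lemma card_first_in (P : {set {perm T}}) B x :
  {in B &, forall y z s, s \in P -> (tperm y z * s)%g \in P} ->
  x \in B -> #|B| * #|P :&: first_in B x| = #|P|.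
Proof.
move=> hP xB.
have -> : #|P| = \sum_(y in B) #|P :&: first_in B y|.
  under eq_bigr => y _ do rewrite -sum1dep_card big_mkcondr.
  rewrite exchange_big /= -sum1_card; apply: eq_bigr => s _.
  have [y hy] := first_in_ex s xB.
  rewrite -big_mkcondr (big_pred1 y) // => z /=.
  apply/andP/eqP => [[_ hz] | ->]; first exact: first_in_uniq hz hy.
  by split=> //; case/first_inP: hy.
rewrite -sum_nat_const; apply: eq_bigr => y yB.
rewrite -(card_imset _ (mulgI (tperm x y))); apply: eq_card => s.
apply/imsetP/idP => [[t] | ].
  by move=> /setIP[tP ht] ->; rewrite in_setI hP // first_in_tperm // tpermR.
move=> /setIP[sP hs]; exists (tperm x y * s)%g; last first.
  by rewrite mulgA tperm2 mul1g.
by rewrite in_setI hP //= first_in_tperm // tpermL.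
Qed.

Lemma card_firstT B x : x \in B -> #|B| * #|first_in B x| = #|{perm T}|.
Proof.
move=> xB; rewrite -[first_in B x]setTI (card_first_in _ xB) ?cardsT //.
by move=> y z _ _ s _; rewrite in_setT.
Qed.

(** If x is first in A and precedes all of B, the relative order within B remains
    uniform, because transposing two elements of B does not move x. *)
Lemma card_first2 A B x y :
  x \in A -> y \in A -> x \notin B -> y \in B ->
  #|B| * #|first_in A x :&: first_in B y| = #|first_in (A :|: B) x|.
Proof.
move=> xA yA xB yB.
have -> : first_in A x :&: first_in B y = first_in (A :|: B) x :&: first_in B y.
  apply/setP => s; rewrite !in_setI.
  case hB: (s \in first_in B y); rewrite ?andbF ?andbT //.
  apply/idP/idP => [hA|]; first exact: first_in_sup yA hA hB.
  by apply: (subsetP (first_in_sub _ _)); rewrite ?subsetUl.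
apply: card_first_in yB => u v uB vB s hs.
rewrite first_in_tperm ?in_setU ?uB ?vB ?orbT //.
rewrite tpermD //.
  by apply: contraNneq xB => <-.
by apply: contraNneq xB => <-.
Qed.

End FirstInOrder.

(** Transfers counts from the orders to the colors, which have to be ordinals. *)
Lemma card_enum_val_preim (W : finType) (X : {set W}) :
  #|[set j : 'I_#|W| | enum_val j \in X]| = #|X|.
Proof.
rewrite -(card_imset _ (@enum_val_inj W predT)); apply: eq_card => w.
apply/imsetP/idP => [[j + ->]|wX]; first by rewrite inE.
by exists (enum_rank w); rewrite ?inE enum_rankK.
Qed.

(** * The random stable set *)

Section Construction.
Variables (G : sgraph) (D : nat).
Hypothesis maxD : max_degree G <= D.
Implicit Types u v w : G.

Let T : finType := (G + 'I_D.+1)%type.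

Definition closed_nbh v : {set T} := [set inl u | u in v |: nbh v].

(** Different vertices may use the same dummies: the estimates depend only on the
    size of the padded sets and on the vertices of G that they contain. *)
Definition padded_nbh v : {set T} :=
  closed_nbh v :|: [set inr k | k : 'I_D.+1 & k < D - #|nbh v|].

Definition chosen v : {set {perm T}} := first_in (padded_nbh v) (inl v).

Lemma nbhE v w : (w \in nbh v) = edge v w. Proof. by rewrite inE. Qed.

Lemma nbh_le v : #|nbh v| <= D.
Proof. by apply: leq_trans maxD; apply: (leq_bigmax v). Qed.

Lemma mem_closed_nbh v w : (inl w \in closed_nbh v) = (w == v) || edge v w.
Proof. by rewrite mem_imset ?inE //; exact: inl_inj. Qed.

Lemma mem_padded_nbh v w : (inl w \in padded_nbh v) = (w == v) || edge v w.
Proof.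
rewrite in_setU mem_closed_nbh; case: imsetP => [[k _ //]|_]; exact: orbF.
Qed.

Lemma card_closed_nbh v : #|closed_nbh v| = #|nbh v|.+1.
Proof.
by rewrite card_imset ?cardsU1 ?nbhE ?edge_irrefl //; exact: inl_inj.
Qed.

Lemma card_padded_nbh v : #|padded_nbh v| = D.+1.
Proof.
rewrite cardsU card_closed_nbh card_imset; last exact: inr_inj.
rewrite disjoint_setI0 ?cards0; last first.
  rewrite disjoint_subset; apply/subsetP => _ /imsetP[u _ ->].
  by rewrite !inE; apply/imsetP => -[].
suff -> : #|[set k : 'I_D.+1 | k < D - #|nbh v| ]| = D - #|nbh v|.
  by have := nbh_le v; lia.
rewrite -sum1dep_card -(big_ord_widen D.+1 (fun=> 1)); last by lia.
by rewrite sum1_card card_ord.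
Qed.

Lemma card_chosen v : D.+1 * #|chosen v| = #|{perm T}|.
Proof. by rewrite -(card_padded_nbh v) card_firstT // mem_padded_nbh eqxx. Qed.

(** Each of v and w lies in the padded set of the other, so neither can precede
    the other. *)
Lemma chosen_adj v w : edge v w -> chosen v :&: chosen w = set0.
Proof.
move=> vw; apply/setP => s; rewrite !in_set0 inE; apply/negP => /andP[hv hw].
have := @first_in_antisym _ _ _ (inl v) (inl w) s _ _ hv hw.
rewrite !mem_padded_nbh vw edge_sym vw !orbT => /(_ isT isT) [vEw].
by rewrite vEw edge_irrefl in vw.
Qed.

(** Nonadjacency puts x outside the padded set of y, so being first in A for x
    and first in that set for y are compatible, and the latter has conditional
    probability 1 / (D + 1) once x precedes the whole set. *)
Lemma card_first_chosen (A : {set T}) x y :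
  inl x \in A -> inl y \in A -> x != y -> ~~ edge x y ->
  D.+1 * #|first_in A (inl x) :&: chosen y|
    = #|first_in (A :|: padded_nbh y) (inl x)|.
Proof.
move=> xA yA xDy xy; rewrite -(@card_first2 _ A (padded_nbh y) _ (inl y)) //.
- by rewrite card_padded_nbh.
- by rewrite mem_padded_nbh edge_sym (negbTE xDy).
- by rewrite mem_padded_nbh eqxx.
Qed.

(** The factor 2 accounts for which of the two vertices comes first.  The earlier
    one precedes D + 1 other points: the later one and its own padded set. *)
Lemma card_chosen2 v w : v != w ->
  D.+2 * (D.+1 * #|chosen v :&: chosen w|) <= 2 * #|{perm T}|.
Proof.
move=> vDw; case vw: (edge v w); first by rewrite chosen_adj ?cards0 ?muln0.
wlog suff half : / forall x y, x != y -> ~~ edge x y ->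
    D.+2 * (D.+1 * #|first_in (inl y |: padded_nbh x) (inl x) :&: chosen y|)
    <= #|{perm T}|.
  have : chosen v :&: chosen w \subset
      (first_in (inl w |: padded_nbh v) (inl v) :&: chosen w)
      :|: (first_in (inl v |: padded_nbh w) (inl w) :&: chosen v).
    apply/subsetP => s /setIP[hv hw]; rewrite in_setU !in_setI hv hw !andbT.
    case/first_inP: (hv) => iv lv; case/first_inP: (hw) => iw lw.
    apply/orP; case: (leqP (enum_rank (s (inl v))) (enum_rank (s (inl w)))) => h.
      left; apply/first_inP; split; first by rewrite inE iv orbT.
      by move=> z /setU1P[-> //|/lv].
    right; apply/first_inP; split; first by rewrite inE iw orbT.
    by move=> z /setU1P[-> |/lw //]; apply: ltnW.
  move=> /subset_leq_card/leq_trans/(_ (leq_card_setU _ _)) h.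
  rewrite mulnA; apply: leq_trans (leq_mul (leqnn _) h) _.
  have h1 := half v w vDw (negbT vw).
  have h2 : ~~ edge w v by rewrite edge_sym vw.
  have := half w v _ h2; rewrite eq_sym => /(_ vDw) h3.
  by rewrite mulnDr mul2n -addnn -!mulnA leq_add.
move=> x y xDy xy.
rewrite card_first_chosen ?in_setU1 ?mem_padded_nbh ?eqxx ?orbT //.
set A := (X in first_in X).
have xA : inl x \in A by rewrite in_setU in_setU1 mem_padded_nbh eqxx orbT.
rewrite -(card_firstT xA) leq_mul2r; apply/orP; right.
have <- : #|inl y |: padded_nbh x| = D.+2.
  by rewrite cardsU1 card_padded_nbh mem_padded_nbh eq_sym (negbTE xDy) (negbTE xy).
exact/subset_leq_card/subsetUl.
Qed.

Definition chosen_only v x : {set {perm T}} :=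
  chosen x :\: \bigcup_(y in nbh v :\ x) chosen y.

(** That x precedes N[v] and its own padded set has probability at least
    1 / (D + d), where d is the degree of v.  The padded set of x shares both v and
    x with N[v], which saves 2 in the size of the union.  Each of the d - 1 other
    neighbors of v spoils the event with conditional probability at most
    1 / (D + 1). *)
Lemma card_chosen_only v x : x \in nbh v ->
  (D.+2 - #|nbh v|) * #|{perm T}|
    <= (D + #|nbh v|) * (D.+1 * #|chosen_only v x|).
Proof.
move=> xv; have vx : edge v x by rewrite -nbhE.
set d := #|nbh v|; have dD : d <= D := nbh_le v.
have d0 : 0 < d by apply/card_gt0P; exists x.
pose A := padded_nbh x :|: closed_nbh v.
pose F := first_in A (inl x).
have xS : inl x \in padded_nbh x by rewrite mem_padded_nbh eqxx.
have xA : inl x \in A by rewrite inE xS.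
have FS : F \subset chosen x by apply: first_in_sub; rewrite ?subsetUl.
have cA : #|A| <= D + d.
  have : [set inl v; inl x] \subset padded_nbh x :&: closed_nbh v.
    apply/subsetP => z /set2P[] ->; rewrite inE mem_padded_nbh mem_closed_nbh.
      by rewrite edge_sym vx eqxx orbT.
    by rewrite vx eqxx orbT.
  move=> /subset_leq_card; rewrite cards2 (inj_eq inl_inj).
  have -> : v != x by apply: contraTneq vx => ->; rewrite edge_irrefl.
  rewrite /A cardsU card_padded_nbh card_closed_nbh -/d.
  by move: #|_ :&: _| => c /=; lia.
have cF : #|A| * #|F| = #|{perm T}| by apply: card_firstT.
have pair y : y \in nbh v :\ x -> D.+1 * #|F :&: chosen y| <= #|F|.
  move=> /setD1P[yx yv].
  case xy: (edge x y).
    suff -> : F :&: chosen y = set0 by rewrite cards0 muln0.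
    by apply/eqP; rewrite -subset0 -(chosen_adj xy) setSI.
  have yA : inl y \in A by rewrite inE mem_closed_nbh -nbhE yv !orbT.
  rewrite card_first_chosen ?xy // 1?eq_sym //.
  by apply/subset_leq_card/first_in_sub; rewrite ?subsetUl.
have sub : F :\: \bigcup_(y in nbh v :\ x) (F :&: chosen y) \subset chosen_only v x.
  apply/subsetP => s /setDP[sF sn]; rewrite inE (subsetP FS) // andbT.
  apply: contra sn => /bigcupP[y yv sy].
  by apply/bigcupP; exists y => //; rewrite inE sF.
have {sub} := subset_leq_card sub; rewrite cardsD => sub.
have cU : D.+1 * #|F :&: \bigcup_(y in nbh v :\ x) (F :&: chosen y)|
          <= d.-1 * #|F|.
  have -> : d.-1 = #|nbh v :\ x| by rewrite /d [in LHS](cardsD1 x) xv.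
  rewrite -sum_nat_const.
  apply: (@leq_trans (D.+1 * \sum_(y in nbh v :\ x) #|F :&: chosen y|)).
    rewrite leq_mul2l; apply: leq_trans (card_bigcup_le _ _).
    exact/subset_leq_card/subsetIr.
  by rewrite big_distrr; apply: leq_sum.
rewrite -cF.
set f := #|F| in cF cU sub *; set c := #|F :&: _| in cU sub.
set e := #|chosen_only v x| in sub *.
have : (D.+2 - d) * f <= D.+1 * e by nia.
move=> h; rewrite mulnCA; exact: leq_mul.
Qed.

(** The events that a given neighbor of v is the only one chosen are disjoint, so
    the bounds of [card_chosen_only] add up over the d neighbors. *)
Lemma card_chosen_once v : nbh v != set0 ->
  #|{perm T}| <= D.+1 * #|[set s | #|[set x in nbh v | s \in chosen x]| == 1]|.
Proof.
move=> /set0Pn[x0 x0v]; set d := #|nbh v|.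
have dD : d <= D := nbh_le v.
have d0 : 0 < d by apply/card_gt0P; exists x0.
set E := [set s | _].
have hE : \sum_(x in nbh v) #|chosen_only v x| <= #|E|.
  have only_in x s : x \in nbh v -> s \in chosen_only v x ->
      [set y in nbh v | s \in chosen y] = [set x].
    move=> xv /setDP[sx sn]; apply/setP => y; rewrite in_set1 in_set.
    apply/andP/eqP => [[yv sy]|-> //].
    apply: contraNeq sn => yx; apply/bigcupP; exists y => //.
    by rewrite in_setD1 yx.
  under eq_bigr => x _ do rewrite -sum1_card big_mkcond.
  rewrite exchange_big -sum1_card [leqRHS]big_mkcond; apply: leq_sum => s _.
  rewrite -big_mkcondr sum1_card.
  case: (set_0Vmem [set x in nbh v | s \in chosen_only v x]) => [h|[x]].
    rewrite (@eq_card0 _ (fun x => _)) // => x; have /setP/(_ x) := h.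
    by rewrite in_set in_set0.
  rewrite in_set => /andP[xv sx].
  rewrite [s \in E]in_set (only_in x) // cards1 eqxx.
  rewrite -[leqRHS](cards1 x); apply: subset_leq_card; apply/subsetP => y.
  move=> /andP[yv sy]; rewrite -(only_in x s) // (only_in y s) //; exact: set11.
have : \sum_(x in nbh v) (D.+2 - d) * #|{perm T}| <=
       \sum_(x in nbh v) (D + d) * (D.+1 * #|chosen_only v x|).
  by apply: leq_sum => x; apply: card_chosen_only.
rewrite sum_nat_const -/d -!big_distrr /=.
set n := #|{perm T}|; set e := #|E| in hE *; set f := \sum_(x in _) _ in hE *.
move=> h.
(* The difference of the two sides is (d - 1) * (D - d). *)
have hd : D + d <= d * (D.+2 - d) by nia.
rewrite -(leq_pmul2l (m := D + d)); last by rewrite addn_gt0 d0 orbT.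
apply: (@leq_trans (d * ((D.+2 - d) * n))).
  by rewrite mulnA leq_mul2r hd orbT.
by apply: leq_trans h _; rewrite leq_mul2l leq_mul2l hE !orbT.
Qed.

End Construction.

(** The number b of orders in which a vertex is chosen is computed as the number
    of orders in which a fixed dummy is first among all D + 1 dummies; in this
    form a = (D + 1) b also holds when G has no vertex. *)
Lemma pcf_coloring_exists (G : sgraph) (D : nat) :
  2 <= D -> max_degree G <= D ->
  exists (a b : nat) (phi : G -> {set 'I_a}),
    [/\ 0 < b, a = D.+1 * b, fractional_pcf_coloring b phi
      & forall v w, v != w -> 2 * #|phi v :&: phi w| <= b].
Proof.
move=> D2 maxD.
pose T : finType := (G + 'I_D.+1)%type.
pose dummies : {set T} := [set inr k | k in 'I_D.+1].
have d0 : inr ord0 \in dummies by apply: imset_f.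
pose b := #|first_in dummies (inr ord0)|.
have aE : D.+1 * b = #|{perm T}|.
  by rewrite -(card_firstT d0) card_imset ?card_ord //; exact: inr_inj.
pose phi (v : G) := [set j : 'I_#|{perm T}| | enum_val j \in chosen D v].
have phiE v j : (j \in phi v) = (enum_val j \in chosen D v) by rewrite in_set.
have phib v : #|phi v| = b.
  rewrite card_enum_val_preim; apply/eqP.
  by rewrite -(eqn_pmul2l (m := D.+1)) // aE card_chosen.
have phiI v w : #|phi v :&: phi w| = #|chosen D v :&: chosen D w|.
  rewrite -(card_enum_val_preim (chosen D v :&: _)).
  by apply: eq_card => j; rewrite in_setI !in_set.
have P0 : 0 < #|{perm T}| by apply/card_gt0P; exists 1%g.
exists #|{perm T}|, b, phi; split => //.
- by move: P0; rewrite -aE; case: (b); rewrite ?muln0.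
- split; first split=> //.
    move=> j v w; rewrite [v \in _]in_set [w \in _]in_set !phiE.
    move=> hv hw; apply/negP => vw.
    suff : enum_val j \in chosen D v :&: chosen D w by rewrite chosen_adj ?in_set0.
    by rewrite in_setI hv.
  move=> v /eqP nv; have := card_chosen_once maxD nv.
  rewrite -[leqLHS]aE leq_mul2l /= => /leq_trans; apply.
  rewrite -card_enum_val_preim; apply/subset_leq_card/subsetP => j.
  rewrite !in_set; congr (_ == 1); apply: eq_card => x.
  by rewrite in_setI !in_set.
- move=> v w vw; rewrite phiI; have := card_chosen2 maxD vw.
  by rewrite -aE; nia.
Qed.

(** * Vertices using few colors *)

Section Components.
Variable G : sgraph.
Implicit Types (S K : {set G}).

(** If no vertex of S has two neighbors in S, the component of x consists of x and
    its neighbor in S, if it has one. *)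
Lemma component_le2 S K :
  (forall v, v \in S -> {in S &, forall u w, edge v u -> edge v w -> u = w}) ->
  K \in components S -> #|K| <= 2.
Proof.
move=> hS /imsetP[x xS ->]; set e := induced_edge S.
have eS u v : e u v -> [/\ u \in S, v \in S & edge u v] by case/and3P.
(* The neighbor of x in S, or x itself when there is none. *)
pose y := odflt x [pick y | e x y].
suff sub : [set z in S | connect e x z] \subset [set x; y].
  by apply: leq_trans (subset_leq_card sub) _; rewrite cards2; case: eqP.
have step u v : e u v -> u \in [set x; y] -> v \in [set x; y].
  move=> /eS[_ vS uv]; move: uv => /[swap]; rewrite /y.
  case: pickP => [z /eS[_ zS xz]|none] /set2P[] -> uv; rewrite in_set2 /=.
  - by rewrite (hS _ xS _ _ vS zS uv xz) eqxx orbT.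
  - by rewrite (hS _ zS _ _ vS xS uv) ?eqxx // edge_sym.
  - by move: (none v); rewrite /e /induced_edge /= xS vS uv.
  - by move: (none v); rewrite /e /induced_edge /= xS vS uv.
have walk p u : u \in [set x; y] -> path e u p -> last u p \in [set x; y].
  by elim: p u => //= t p IH u uxy /andP[/step/(_ uxy)]; apply: IH.
apply/subsetP => z; rewrite in_set => /andP[_ /connectP[p ep ->]].
exact: walk (set21 x y) ep.
Qed.

(** A vertex v with two neighbors u and w would force
    #|C| >= b + #|phi u :|: phi w| >= b + 3 b / 2. *)
Lemma bichromatic_component_le2 (a b : nat) (phi : G -> {set 'I_a})
    (C : {set 'I_a}) K :
  proper_coloring b phi ->
  (forall v w, v != w -> 2 * #|phi v :&: phi w| <= b) ->
  2 * #|C| < 5 * b ->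
  K \in components (vertices_using_only phi C) -> #|K| <= 2.
Proof.
move=> [phib st] pair hC; apply: component_le2 => v + u w.
rewrite !in_set => vC uC wC vu vw; apply/eqP; apply: contraTT hC => uDw.
have disj x : edge v x -> phi v :&: phi x = set0.
  move=> vx; apply/setP => j; rewrite in_set0 in_setI; apply/negP => /andP[jv jx].
  by have := st j v x; rewrite !in_set jv jx vx => /(_ isT isT).
have : phi v :|: (phi u :|: phi w) \subset C by rewrite !subUset vC uC wC.
move=> /subset_leq_card; rewrite cardsU setIUr !disj // setU0 cards0 cardsU !phib.
have := pair u w uDw; lia.
Qed.

End Components.

Unset Implicit Arguments.
Import Order.TTheory GRing.Theory Num.Theory.
Local Open Scope ring_scope.

Theorem corollary8 (R : realType) (eps : R) (heps : 0 < eps) :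
  exists d0 : R,
    forall (Delta : R) (G : sgraph),
      d0 <= Delta ->
      (max_degree G)%:R <= Delta ->
      exists (a b : nat) (phi : G -> {set 'I_a}),
        (0 < a)%N /\ (0 < b)%N /\
        a%:R <= (1 + eps) * Delta * b%:R /\
        proper_coloring b phi /\
        fractional_pcf_coloring b phi /\
        (forall C : {set 'I_a},
            (#|C|%:R : R) < 5%:R * b%:R / 2%:R ->
            forall K : {set G},
              K \in components (vertices_using_only phi C) ->
              (#|K| <= 2)%N) /\
        (forall v w : G, v != w ->
            (#|phi v :&: phi w|%:R : R) <= b%:R / 2%:R).
Proof.
exists (Num.max 2%:R eps^-1) => Delta G; rewrite ge_max.
move=> /andP[D2 Deps] Dmax; pose D := maxn 2 (max_degree G).
have DD : D%:R <= Delta by rewrite /D; case: leqP.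
have [a [b [phi [b0 aE pcf pair]]]] :=
  pcf_coloring_exists (leq_maxl 2 (max_degree G)) (leq_maxr 2 (max_degree G)).
have D1 : 1 <= eps * Delta by rewrite mulrC -ler_pdivrMr // div1r.
exists a, b, phi; split; first by rewrite aE muln_gt0.
split=> //; split.
  rewrite aE natrM ler_wpM2r ?ler0n // -/D -natr1 mulrDl mul1r.
  by rewrite lerD.
split; first by case: pcf.
split=> //; split.
  move=> C hC K; apply: (bichromatic_component_le2 _ pair); first by case: pcf.
  rewrite -(ltr_nat R) !natrM; lra.
move=> v w /pair; rewrite -(ler_nat R) natrM; lra.
Qed.
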